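(* Let $n_1,\dots,n_k\ge1$ and $d_1,\dots,d_k\ge1$ be integers, let $$v_{d_1,\dots,d_k}\colon\mathbb{P}^{n_1}\times\dots\times\mathbb{P}^{n_k}\to\mathbb{P}(\operatorname{Sym}^{d_1}\mathbb{C}^{n_1+1}\otimes\dots\otimes\operatorname{Sym}^{d_k}\mathbb{C}^{n_k+1})$$ be the Segre–Veronese embedding, and put $d=d_1+\dots+d_k$. Let $F\in\operatorname{Sym}^{d_1}\mathbb{C}^{n_1+1}\otimes\dots\otimes\operatorname{Sym}^{d_k}\mathbb{C}^{n_k+1}$ be a non-zero form. Then $$\mathrm{cr}(F)\le\sum_{\substack{(e_1,\dots,e_k)\\ e_1+\dots+e_k\le d/2}}\binom{n_1-1+e_1}{e_1}\cdots\binom{n_k-1+e_k}{e_k}+\sum_{\substack{(e_1,\dots,e_k)\\ e_1+\dots+e_k>d/2}}\binom{n_1-1+d_1-e_1}{d_1-e_1}\cdots\binom{n_k-1+d_k-e_k}{d_k-e_k},$$ where both sums run over integer tuples with $0\le e_i\le d_i$ for all $i$.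
   Context: The base field is $\mathbb{C}$; $\operatorname{Sym}^i$ denotes the space of $i$-th symmetric tensors. The Segre–Veronese embedding is $([v_1],\dots,[v_k])\mapsto[v_1^{d_1}\otimes\dots\otimes v_k^{d_k}]$ (it is the embedding by the complete linear system of $\mathcal{O}(d_1,\dots,d_k)$). With $X$ the image of this embedding, the cactus rank of $F$ is $\mathrm{cr}(F)=\min\{\operatorname{length}R: R\hookrightarrow X \text{ closed subscheme},\ \dim R=0,\ [F]\in\langle R\rangle\}$, where $\operatorname{length}R=\dim_{\mathbb{C}}H^0(R,\mathcal{O}_R)$ and $\langle R\rangle$ is the smallest projective linear subspace of the ambient projective space through which the inclusion of $R$ factors. *)

(* Defs.v *)
From HB Require Import structures.
From mathcomp Require Import all_boot all_order all_algebra all_fingroup all_field.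
From mathcomp Require Import mpoly.
From mathcomp Require Import complex reals.

Set Implicit Arguments.
Unset Strict Implicit.
Unset Printing Implicit Defensive.

Import GRing.Theory.
Local Open Scope ring_scope.

(* The space (K^(n_0+1))^{(x) d_0} (x) ... (x) (K^(n_(k-1)+1))^{(x) d_(k-1)} is
   represented by its coordinates: a multi-index t selects, for the s-th copy
   of the i-th factor, a basis vector t i s. *)
Definition tensor_idx (k : nat) (n d : 'I_k -> nat) :=
  {dffun forall i : 'I_k, {ffun 'I_(d i) -> 'I_(n i).+1}}.

Definition permute_idx (k : nat) (n d : 'I_k -> nat)
    (sg : forall i : 'I_k, 'S_(d i)) (t : tensor_idx n d) : tensor_idx n d :=
  [ffun i : 'I_k => [ffun s : 'I_(d i) => t i (sg i s)]].

(* Elements of B (x) Sym^{d_0} (x) ... (x) Sym^{d_(k-1)}: the tensors that are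
   symmetric separately in each block of indices.  We need both B = K and
   B = a K-algebra. *)
Definition block_symmetric (k : nat) (n d : 'I_k -> nat) (B : Type)
    (T : tensor_idx n d -> B) : Prop :=
  forall (sg : forall i : 'I_k, 'S_(d i)) t, T (permute_idx sg t) = T t.

Definition segre_veronese (K : fieldType) (k : nat) (n d : 'I_k -> nat)
    (v : forall i : 'I_k, 'rV[K]_(n i).+1) : {ffun tensor_idx n d -> K^o} :=
  [ffun t : tensor_idx n d => \prod_(i < k) \prod_(s < d i) v i 0 (t i s)].

(* Zero-dimensional closed subschemes of a projective space.

   A nonempty zero-dimensional scheme of finite type over K is Spec A for a
   nonzero finite-dimensional commutative K-algebra A = H^0(R, O_R), so its
   length is \dim {:A}.  (The empty scheme has empty span, so it never matters
   for the cactus rank.)  Line bundles on Spec A are trivial, so a morphism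
   from Spec A to the projective space with homogeneous coordinates (z_i)_i,
   i : I, is given by a family a : I -> A generating the unit ideal, with z_i
   pulled back to a i; a is unique up to a unit of A. *)
Definition unimodular (K : fieldType) (A : falgType K) (I : finType)
    (a : I -> A) : Prop :=
  exists c : I -> A, \sum_i c i * a i = 1.

(* The variable of index j is the coordinate enum_val j. *)
Definition pullback (K : fieldType) (A : falgType K) (I : finType)
    (a : I -> A) (p : {mpoly K[#|I|]}) : A :=
  mmap (in_alg A) (fun j => a (enum_val j)) p.

(* On each chart D_+(z_i), whose preimage in Spec A is Spec A[1/a_i], the ring
   map K[z_j / z_i] -> A[1/a_i] is onto.  Elements of the source are the p/z_i^m
   with p homogeneous of degree m, and the last equation spells out
   b / a_i^s = p(a) / a_i^m in the localization. *)
Definition closed_immersion (K : fieldType) (A : falgType K) (I : finType)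
    (a : I -> A) : Prop :=
  forall (i : I) (b : A) (s : nat),
    exists (m u : nat) (p : {mpoly K[#|I|]}),
      p \is m.-homog /\
      a i ^+ u * (a i ^+ m * b - a i ^+ s * pullback a p) = 0.

(* The morphism given by a factors through P(W), i.e. a lies in A (x) W. *)
Definition factors_through_linear (K : fieldType) (A : falgType K) (I : finType)
    (a : I -> A) (W : {vspace {ffun I -> K^o}}) : Prop :=
  exists c : 'I_(\dim W) -> A,
    forall t, a t = \sum_j (tnth (vbasis W) j t : K) *: c j.

(* The morphism given by a factors through the Segre-Veronese variety with its
   reduced structure: every form vanishing on all points of the variety pulls
   back to 0.  Forms on the space of symmetric tensors are the restrictions of
   forms in all the tensor coordinates. *)
Definition factors_through_segre_veronese (K : closedFieldType) (k : nat)
    (n d : 'I_k -> nat) (A : falgType K) (a : tensor_idx n d -> A) : Prop :=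
  forall (m : nat) (p : {mpoly K[#|{: tensor_idx n d}|]}),
    p \is m.-homog ->
    (forall v : forall i : 'I_k, 'rV[K]_(n i).+1,
       (forall i, v i != 0) ->
       p.@[fun j => segre_veronese d v (enum_val j)] = 0) ->
    pullback a p = 0.

(* [F] lies in the smallest linear subspace P(W) of
   P(Sym^{d_0} (x) ... (x) Sym^{d_(k-1)}) through which a factors. *)
Definition in_linear_span (K : fieldType) (k : nat) (n d : 'I_k -> nat)
    (A : falgType K) (a : tensor_idx n d -> A)
    (F : {ffun tensor_idx n d -> K^o}) : Prop :=
  forall W : {vspace {ffun tensor_idx n d -> K^o}},
    (forall T, T \in W -> block_symmetric T) ->
    factors_through_linear a W -> F \in W.

Definition in_span_of_length (K : closedFieldType) (k : nat)
    (n d : 'I_k -> nat) (F : {ffun tensor_idx n d -> K^o}) (r : nat) : Prop :=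
  exists (A : falgType K) (a : tensor_idx n d -> A),
    [/\ (commutative (@GRing.mul A)),
        (block_symmetric a /\ unimodular a /\ closed_immersion a),
        factors_through_segre_veronese a,
        \dim {:A} = r
      & in_linear_span a F].

Definition is_cactus_rank (K : closedFieldType) (k : nat)
    (n d : 'I_k -> nat) (F : {ffun tensor_idx n d -> K^o}) (r : nat) : Prop :=
  in_span_of_length F r /\
  forall r' : nat, in_span_of_length F r' -> (r <= r')%N.

(* Main.v *)
Require Import Defs.
From HB Require Import structures.
From mathcomp Require Import all_boot all_order all_algebra all_fingroup all_field.
From mathcomp Require Import mpoly.
From mathcomp Require Import complex reals.
From mathcomp Require Import boolp zify.

(** The idea is to restrict F to the affine chart of the product of projective
    spaces on which every 0-th coordinate is 1.  In divided powers this turns F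
    into a polynomial f in n_1 + ... + n_k variables of multidegree at most
    (d_1, ..., d_k), whose coefficients are the entries of F.  Let A be the
    apolar algebra of f, the polynomial ring modulo the annihilator of f for
    contraction.  Pairing with f gives a functional psi on A for which
    (b, b') |-> psi (b b') is nondegenerate.

    The chart embeds Spec A in the Segre-Veronese variety: the coordinate t is
    sent to the class a t of a monomial, and F t = psi (a t), so F lies in the
    linear span of Spec A (apolar_scheme).  The pullback of an equation of the
    variety vanishes because the corresponding polynomial on the chart vanishes
    at every point (mpoly_eq0_eval).

    It remains to bound the length dim A (apolar_dim_le).  The algebra A is
    spanned by the monomials of multidegree at most d.  Those of total degree at
    most D / 2, where D = d_1 + ... + d_k, are counted by the first sum.  The
    span of those of total degree above D / 2 is paired nontrivially only with
    monomials of total degree below D / 2, so its dimension is at most the number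
    of the latter; the substitution e |-> d - e turns that count into the second
    sum. *)

Set Implicit Arguments.
Unset Strict Implicit.
Unset Printing Implicit Defensive.

Import GRing.Theory Num.Theory.
Local Open Scope ring_scope.

(** * Polynomials vanishing at every point *)

Lemma digits_inj B N (f g : 'I_N -> nat) :
  (forall i, f i < B)%N -> (forall i, g i < B)%N ->
  (\sum_i f i * B ^ i = \sum_i g i * B ^ i)%N -> f =1 g.
Proof.
elim: N f g => [|N IH] f g fB gB; first by move=> _ [].
have shift (h : 'I_N.+1 -> nat) :
    (\sum_i h i * B ^ i = \sum_i h (lift ord0 i) * B ^ i * B + h ord0)%N.
  rewrite big_ord_recl expn0 muln1 addnC; congr addn.
  by apply: eq_bigr => i _; rewrite /bump /= expnSr mulnA.
rewrite !shift -!big_distrl /= => E.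
have E0 : f ord0 = g ord0.
  by have := congr1 (modn^~ B) E; rewrite /= !modnMDl !modn_small.
have B_gt0 : (0 < B)%N by apply: leq_ltn_trans (fB ord0).
move/eqP: E; rewrite E0 eqn_add2r eqn_pmul2r // => /eqP /IH E.
by move=> i; case: (unliftP ord0 i) => [j|] -> //; apply: E.
Qed.

(** Kronecker substitution: for B larger than every exponent, sending the i-th
    variable to x ^ (B ^ i) keeps distinct monomials distinct, so it reduces the
    claim to one variable, where infinitely many roots force zero. *)
Lemma mpoly_eq0_eval (K : numFieldType) N (p : {mpoly K[N]}) :
  (forall v : 'I_N -> K, p.@[v] = 0) -> p = 0.
Proof.
move=> p0; pose B := msize p; pose code (m : 'X_{1..N}) := (\sum_i m i * B ^ i)%N.
pose q : {poly K} := \sum_(m <- msupp p) p@_m *: 'X^(code m).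
have q_eval x : q.[x] = 0.
  rewrite -[RHS](p0 (fun i => x ^+ (B ^ i))) mevalE horner_sum.
  apply: eq_bigr => m _; rewrite hornerZ hornerXn expr_sum; congr (_ * _).
  by apply: eq_bigr => i _; rewrite mulnC exprM.
have q0 : q = 0.
  apply: (@roots_geq_poly_eq0 _ _ [seq i%:R | i <- iota 0 (size q)]).
  - by apply/allP => x _; apply/rootP.
  - by rewrite map_inj_uniq ?iota_uniq // => i j /eqP; rewrite eqr_nat => /eqP.
  - by rewrite size_map size_iota.
apply/eqP; rewrite -msupp_eq0; case E: (msupp p) => [//|m0 s].
have m0p : m0 \in msupp p by rewrite E mem_head.
have digit_lt m i : m \in msupp p -> (m i < B)%N.
  move=> /msize_mdeg_lt; apply: leq_ltn_trans.
  by rewrite mdegE (bigD1 i) //= leq_addr.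
have /eqP := congr1 (fun r : {poly K} => r`_(code m0)) q0.
rewrite coef0 coef_sum (bigD1_seq m0) //= coefZ coefXn eqxx mulr1.
rewrite big_seq_cond big1 => [|m /andP[mp m_neq]]; last first.
  rewrite coefZ coefXn; case: eqP => [C|]; last by rewrite mulr0.
  case/negP: m_neq; apply/eqP/mnmP.
  apply: (@digits_inj B) => [i|i|]; [exact: digit_lt | exact: digit_lt |].
  exact: esym C.
by rewrite addr0 mcoeff_eq0 m0p.
Qed.

(** * The apolar algebra of a functional *)

Lemma rank_factorization (K : fieldType) m n (A : 'M[K]_(m, n)) : A != 0 ->
  exists r (C : 'M[K]_(m, r.+1)) (R : 'M[K]_(r.+1, n)) C' R',
    [/\ A = C *m R, C' *m C = 1%:M & R *m R' = 1%:M].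
Proof.
rewrite -mxrank_eq0; have := mulmx_base A; have := col_base_full A.
have := row_base_free A; move: (col_base A) (row_base A).
case: (\rank A) => // r C R Rf Cf <- _; exists r, C, R, (pinvmx C), (pinvmx R).
by rewrite mulVpmx // mulmxVp.
Qed.

Section Apolar.
(** phi plays the part of a polynomial f of degree at most D acted on by
    contraction: phi p is the constant term of p . f, and the apolar algebra is
    the quotient of the polynomial ring by the annihilator of f. *)
Variables (K : fieldType) (N D : nat) (phi : {linear {mpoly K[N]} -> K^o}).
Hypothesis phi_high : forall m, (D < mdeg m)%N -> phi 'X_[m] = 0.

Lemma apolar_mul_high (p : {mpoly K[N]}) m : (D < mdeg m)%N -> phi (p * 'X_[m]) = 0.
Proof.
move=> Dm; rewrite [p]mpolyE mulr_suml linear_sum big1 // => m' _.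
rewrite -scalerAl linearZ_LR -mpolyXD phi_high ?scaler0 //.
by rewrite mdegD ltn_addl.
Qed.

Lemma apolar_trunc (p q : {mpoly K[N]}) :
  phi (q * p) = \sum_(m : 'X_{1..N < D.+1}) p@_m * phi (q * 'X_[m]).
Proof.
have coefE m : p@_m * phi (q * 'X_[m]) =
    \sum_(m' <- msupp p) p@_m' * (m' == m)%:R * phi (q * 'X_[m]).
  rewrite -mulr_suml {1}[p]mpolyE raddf_sum; congr (_ * _).
  by apply: eq_bigr => m' _ /=; rewrite mcoeffZ mcoeffX.
rewrite [p in LHS]mpolyE mulr_sumr linear_sum.
rewrite [RHS](eq_bigr _ (fun (m : 'X_{1..N < D.+1}) _ => coefE m)).
rewrite exchange_big /=; apply: eq_bigr => m' _.
rewrite -scalerAr linearZ_LR.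
have [Dm|mD] := ltnP D (mdeg m').
  rewrite apolar_mul_high // scaler0 big1 // => m _.
  case: eqP => [E|]; last by rewrite mulr0 mul0r.
  by have := bmdeg m; rewrite -E ltnNge Dm.
have mD1 : (mdeg m' < D.+1)%N by [].
rewrite (bigD1 (BMultinom mD1)) //= eqxx mulr1 big1 ?addr0 // => m.
by rewrite -val_eqE /= eq_sym => /negbTE ->; rewrite mulr0 mul0r.
Qed.

Let M := 'X_{1..N < D.+1}.
Let mon (i : 'I_#|{: M}|) : {mpoly K[N]} := 'X_[bmnm (enum_val i)].

(** The form (q, q') |-> phi (p q q').  Monomials of degree at most D suffice as
    a basis, since phi kills every multiple of a monomial of higher degree. *)
Definition hankel (p : {mpoly K[N]}) : 'M[K]_#|{: M}| :=
  \matrix_(i, j) phi (p * mon i * mon j).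

(** Multiplication by p on polynomials truncated in degree D. *)
Let mult (p : {mpoly K[N]}) : 'M[K]_#|{: M}| :=
  \matrix_(i, j) (p * mon i)@_(bmnm (enum_val j)).

Lemma hankel_tr p : (hankel p)^T = hankel p.
Proof. by apply/matrixP => i j; rewrite !mxE mulrAC. Qed.

Lemma hankel_mul p q : mult p *m hankel q = hankel (q * p).
Proof.
apply/matrixP => i j; rewrite !mxE.
have -> : q * p * mon i * mon j = q * mon j * (p * mon i).
  by rewrite -!mulrA [mon j * _]mulrC -!mulrA.
rewrite apolar_trunc (reindex _ (onW_bij _ (enum_val_bij M))) /=.
by apply: eq_bigr => k _; rewrite !mxE [q * mon j * _]mulrAC.
Qed.

Lemma hankel_eq0 p : (forall q, phi (p * q) = 0) <-> hankel p = 0.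
Proof.
split=> [p0|H0 q].
  by apply/matrixP => i j; rewrite !mxE -mulrA.
rewrite apolar_trunc big1 // => m _; apply/eqP; rewrite mulf_eq0; apply/orP; right.
have := congr1 (fun A : 'M_#|{: M}| => A (enum_rank (bm0 : M)) (enum_rank m)) H0.
by rewrite !mxE /mon !enum_rankK mpolyX0 mulr1 => ->.
Qed.

Lemma hankel_linear : linear hankel.
Proof.
move=> a p q; apply/matrixP => i j; rewrite !mxE !mulrDl linearD.
by rewrite -!scalerAl linearZ_LR.
Qed.

(** The quotient of the polynomial ring by the ideal of all p with phi (p q) = 0
    for every q is realised inside a matrix algebra, which makes it a
    finite-dimensional algebra at once.  With hankel 1 = C R a full-rank
    factorisation, and C', R' one-sided inverses, rho p = C' (hankel p) R' is the
    matrix of multiplication by p on the row space of hankel 1; the identity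
    hankel p = C (rho p) R shows that rho has exactly this ideal as kernel. *)
Lemma apolar_algebra : (exists p, phi p != 0) ->
  exists (A : falgType K) (pi : {lrmorphism {mpoly K[N]} -> A})
         (psi : {linear A -> K^o}),
    [/\ forall b, exists p, b = pi p,
        forall p, psi (pi p) = phi p
      & forall b, (forall b', psi (b * b') = 0) -> b = 0].
Proof.
move=> [p0 p0N0].
have H1_neq0 : hankel 1 != 0.
  apply: contraNneq p0N0 => /hankel_eq0 H0.
  by rewrite -[p0]mul1r H0.
have [r [C [R [C' [R' [HCR C'C RR']]]]]] := rank_factorization H1_neq0.
have hankelL p : hankel p = mult p *m C *m R.
  by rewrite -mulmxA -HCR hankel_mul mul1r.
have hankelR p : hankel p = C *m (R *m (mult p)^T).
  by rewrite mulmxA -HCR -(hankel_tr 1) -trmx_mul hankel_mul mul1r hankel_tr.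
pose rho p : 'M[K]_r.+1 := C' *m hankel p *m R'.
have rhoK p : C *m rho p *m R = hankel p.
  have CC' : C *m (C' *m hankel p) = hankel p.
    by rewrite hankelR (mulmxA C') C'C mul1mx.
  have R'R : hankel p *m R' *m R = hankel p.
    by rewrite hankelL -!mulmxA (mulmxA R) RR' mul1mx.
  by rewrite /rho !mulmxA -(mulmxA C C') CC' R'R.
have rho_lin : linear rho.
  move=> a p q; rewrite /rho hankel_linear mulmxDr mulmxDl.
  by rewrite -scalemxAr -scalemxAl.
have rho_eq0 p : hankel p = 0 -> rho p = 0.
  by move=> H0; rewrite /rho H0 mulmx0 mul0mx.
have rho1 : rho 1 = 1.
  by rewrite /rho HCR !mulmxA C'C mul1mx RR'.
have rhoM p q : rho (p * q) = rho p * rho q.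
  rewrite /rho -[LHS]mulmxA.
  have -> : hankel (p * q) = hankel p *m (mult q)^T.
    by rewrite -[RHS]trmxK trmx_mul trmxK hankel_tr hankel_mul hankel_tr.
  rewrite [RHS]/GRing.mul /= [in RHS](hankelR q) [in RHS]hankelL.
  rewrite [in LHS]hankelL -!mulmxA (mulmxA R R') RR' mul1mx.
  by rewrite (mulmxA C' C) C'C mul1mx.
pose rhoL : {linear {mpoly K[N]} -> 'M[K]_r.+1} :=
  HB.pack rho (GRing.isLinear.Build _ _ _ _ rho rho_lin).
have rhoE p : rho p = rhoL p by [].
pose X := [tuple rho (mon i) | i < #|{: M}|].
have rho_mem p : rho p \in <<X>>%VS.
  rewrite rhoE [p]mpolyE linear_sum; apply: rpred_sum => m _.
  rewrite linearZ -rhoE; apply: rpredZ.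
  have [Dm|mD] := ltnP D (mdeg m).
    rewrite rho_eq0 ?rpred0 //; apply/hankel_eq0 => q.
    by rewrite mulrC apolar_mul_high.
  have mD1 : (mdeg m < D.+1)%N by [].
  have -> : 'X_[m] = mon (enum_rank (BMultinom mD1 : M)) by rewrite /mon enum_rankK.
  by apply/memv_span/mapP; exists (enum_rank (BMultinom mD1 : M)); rewrite ?mem_enum.
have rho_onto v : v \in <<X>>%VS -> exists p, v = rho p.
  move=> /coord_span ->; exists (\sum_i coord X i v *: mon i).
  rewrite rhoE linear_sum; apply: eq_bigr => i _.
  by rewrite linearZ -rhoE (nth_map i) ?nth_ord_enum // size_enum_ord.
have asp : is_aspace <<X>>%VS.
  apply/andP; split; first by rewrite has_algid1 // -rho1.
  apply/prodvP => u v /rho_onto[p ->] /rho_onto[q ->].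
  by rewrite -rhoM.
pose A : {aspace 'M[K]_r.+1} := ASpace asp.
have A1 : algid A = 1 by apply/eqP; rewrite algid_eq1 -rho1.
pose pi p : subvs_of A := Subvs (rho_mem p : rho p \in asval A).
have pi_lin : linear pi by move=> a p q; apply: val_inj; rewrite /= rho_lin.
have pi_mul : monoid_morphism pi.
  by split=> [|p q]; apply: val_inj; rewrite /= ?A1 ?rhoM.
pose piL : {lrmorphism {mpoly K[N]} -> subvs_of A} :=
  HB.pack pi (GRing.isLinear.Build _ _ _ _ pi pi_lin)
             (GRing.isMonoidMorphism.Build _ _ pi pi_mul).
(* The entry of hankel p at the pair of trivial monomials is phi p. *)
pose o : 'I_#|{: M}| := enum_rank (bm0 : M).
pose psi (b : subvs_of A) : K^o := (C *m vsval b *m R) o o.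
have psi_lin : linear psi.
  move=> a b c; rewrite /psi; have -> : vsval (a *: b + c) = a *: vsval b + vsval c.
    exact: linearP.
  by rewrite mulmxDr mulmxDl -scalemxAr -scalemxAl !mxE.
pose psiL : {linear subvs_of A -> K^o} :=
  HB.pack psi (GRing.isLinear.Build _ _ _ _ psi psi_lin).
have psi_pi p : psiL (piL p) = phi p.
  by rewrite /= /psi /= rhoK mxE /mon enum_rankK mpolyX0 !mulr1.
have pi_onto (b : subvs_of A) : exists p, b = piL p.
  have [p bp] := rho_onto _ (subvsP b); exists p; exact: val_inj.
exists (subvs_of A), piL, psiL; split=> // b.
have [p ->] := pi_onto b => psi0.
apply/val_inj/rho_eq0/hankel_eq0 => q.
by rewrite -psi_pi rmorphM psi0.
Qed.
End Apolar.

(** * The dimension of the apolar algebra *)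

(** The span of ys embeds in the dual of the span of zs. *)
Lemma dim_le_span_pairing (K : fieldType) (A : falgType K) (psi : {linear A -> K^o})
    (xs ys zs : seq A) :
  (fullv <= <<xs>> + <<ys>>)%VS ->
  (forall b, b \in <<ys>>%VS ->
     (forall z, z \in zs -> psi (b * z) = 0) -> b = 0) ->
  (\dim {:A} <= size xs + size zs)%N.
Proof.
move=> gen inj; pose T b : 'rV[K]_(size zs) := \row_j psi (b * zs`_j).
have T_lin : linear T.
  by move=> a b c; apply/rowP => j; rewrite !mxE mulrDl -scalerAl linearP.
pose TL : {linear A -> 'rV[K]_(size zs)} :=
  HB.pack T (GRing.isLinear.Build _ _ _ _ T T_lin).
have T_inj : (<<ys>> :&: lker (linfun TL) = 0)%VS.
  apply/eqP; rewrite -subv0; apply/subvP => b; rewrite memv_cap memv_ker memv0.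
  move=> /andP[b_ys /eqP]; rewrite lfunE /= => Tb0; apply/eqP/inj => // z z_zs.
  have z_lt : (index z zs < size zs)%N by rewrite index_mem.
  have := congr1 (fun u : 'rV[K]__ => u 0 (Ordinal z_lt)) Tb0.
  by rewrite !mxE /= nth_index.
apply: leq_trans (dimvS gen) _; apply: leq_trans (dimv_add_leqif _ _) _.
apply: leq_add; first exact: dim_span.
rewrite -(limg_dim_eq T_inj); apply: leq_trans (dimvS (subvf _)) _.
by rewrite dimvf /dim /= mul1n.
Qed.

(** Monomials in L contribute at most size L.  The others are orthogonal to
    every monomial outside L', so by nondegeneracy an element of their span is
    determined by its pairings with L'. *)
Lemma apolar_dim_le (K : fieldType) N D (A : falgType K)
    (pi : {lrmorphism {mpoly K[N]} -> A}) (psi : {linear A -> K^o})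
    (L L' : seq 'X_{1..N}) :
  (forall b, exists p, b = pi p) ->
  (forall b, (forall b', psi (b * b') = 0) -> b = 0) ->
  (forall m, (D < mdeg m)%N -> pi 'X_[m] = 0) ->
  (forall m m', m \notin L -> m' \notin L' -> psi (pi 'X_[m + m']) = 0) ->
  (\dim {:A} <= size L + size L')%N.
Proof.
move=> onto nondeg high orth; pose x m := pi 'X_[m].
pose Hs := [seq x (bmnm m) | m in [pred m : 'X_{1..N < D.+1} | bmnm m \notin L]].
rewrite -(size_map x L) -(size_map x L').
apply: (@dim_le_span_pairing _ _ psi _ Hs).
  apply/subvP => b _; have [p ->] := onto b.
  rewrite [p]mpolyE linear_sum; apply: rpred_sum => m _.
  rewrite linearZ; apply: rpredZ.
  have [Dm|mD] := ltnP D (mdeg m); first by rewrite /= high // rpred0.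
  have [mL|mL] := boolP (m \in L).
    by apply: (subvP (addvSl _ _)); apply/memv_span/map_f.
  apply: (subvP (addvSr _ _)); apply/memv_span/mapP.
  have mD1 : (mdeg m < D.+1)%N by [].
  by exists (BMultinom mD1) => //; rewrite mem_enum.
move=> b b_Hs b0; apply: nondeg => b'; have [p ->] := onto b'.
rewrite [p]mpolyE linear_sum mulr_sumr linear_sum big1 // => m' _.
rewrite linearZ -scalerAr linearZ_LR; apply/eqP; rewrite scaler_eq0.
apply/orP; right; apply/eqP.
have [m'L|m'L] := boolP (m' \in L'); first by apply/b0/map_f.
rewrite (coord_span (X := in_tuple Hs) b_Hs) mulr_suml linear_sum big1 // => i _.
rewrite -scalerAl linearZ_LR; apply/eqP; rewrite scaler_eq0.
apply/orP; right; apply/eqP.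
have /mapP[m] := mem_nth 0 (ltn_ord i : (i < size (in_tuple Hs))%N).
by rewrite mem_enum inE /= => mL ->; rewrite -rmorphM -mpolyXD orth.
Qed.

(** * Counting monomials by multidegree *)

Section Blocks.
Variables (k : nat) (n : 'I_k -> nat).
Local Notation N := #|{: {i : 'I_k & 'I_(n i)}}|.

Definition block_var (i : 'I_k) (j : 'I_(n i)) : 'I_N :=
  enum_rank (Tagged (fun i => 'I_(n i)) j).

(** The i-th component of the multidegree. *)
Definition block_deg (m : 'X_{1..N}) (i : 'I_k) : nat :=
  (\sum_(j < n i) m (block_var j))%N.

Lemma big_block (R : Type) (idx : R) (op : Monoid.com_law idx) (f : 'I_N -> R) :
  \big[op/idx]_l f l = \big[op/idx]_i \big[op/idx]_(j < n i) f (block_var j).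
Proof.
rewrite (reindex _ (onW_bij _ (enum_rank_bij _))) /=.
rewrite (sig_big_dep _ _ (fun i (j : 'I_(n i)) => f (block_var j))) /=.
by apply: eq_bigr; case.
Qed.

Lemma mdeg_block m : mdeg m = (\sum_i block_deg m i)%N.
Proof. by rewrite mdegE big_block. Qed.

Lemma block_degD m m' i : block_deg (m + m') i = (block_deg m i + block_deg m' i)%N.
Proof. by rewrite -big_split; apply: eq_bigr => j _; rewrite mnmDE. Qed.

Section Counting.
Hypothesis n_gt0 : forall i, (0 < n i)%N.

(** A monomial of multidegree e is, block by block, a composition of e i into
    n i nonnegative parts. *)
Lemma card_block_deg_eq B (e : 'I_k -> nat) :
  (#|[set m : 'X_{1..N < B} | [forall i, block_deg m i == e i]]|
     <= \prod_i 'C(n i - 1 + e i, e i))%N.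
Proof.
pose tup i := (n i).-1.+1.-tuple 'I_(e i).+1.
pose ntup i : {set tup i} := [set t : tup i | \sum_(j <- t) j == e i]%N.
have -> : \prod_i 'C(n i - 1 + e i, e i) = #|setXn ntup|.
  rewrite cardsXn; apply: eq_bigr => i _; rewrite card_ord_partitions subn1.
  by rewrite -[in LHS]bin_sub ?leq_addl // addnK.
pose pos i (j : 'I_(n i).-1.+1) : 'I_(n i) := cast_ord (prednK (n_gt0 i)) j.
pose f (m : 'X_{1..N < B}) : {dffun forall i, tup i} :=
  [ffun i => [tuple inord (bmnm m (block_var (pos i j))) | j < (n i).-1.+1]].
have sum_pos i (g : 'I_(n i) -> nat) : (\sum_j g j = \sum_j g (pos i j))%N.
  have pos_bij : bijective (pos i).
    by exists (cast_ord (esym (prednK (n_gt0 i)))) => j;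
      rewrite /pos ?cast_ordK ?cast_ordKV.
  by rewrite (reindex _ (onW_bij _ pos_bij)).
have entry m i j :
    m \in [set m : 'X_{1..N < B} | [forall i, block_deg m i == e i]] ->
    (bmnm m (block_var (pos i j)) < (e i).+1)%N.
  rewrite inE => /forallP/(_ i)/eqP <-; rewrite ltnS /block_deg sum_pos.
  by rewrite (bigD1 j) //= leq_addr.
rewrite -(@card_in_imset _ _ f) => [|m m' mS m'S fE].
  apply/subset_leq_card/subsetP => _ /imsetP[m mS ->]; apply/setXnP => i.
  have := mS; rewrite !inE => /forallP/(_ i)/eqP deg_mi; apply/eqP.
  rewrite -[RHS]deg_mi ffunE big_tuple /block_deg sum_pos; apply: eq_bigr => j _.
  by rewrite tnth_mktuple inordK // entry.
apply/val_inj/mnmP => l; rewrite -[l]enum_valK.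
case: (enum_val l) => i j; rewrite -[enum_rank _]/(block_var j).
have -> : j = pos i (cast_ord (esym (prednK (n_gt0 i))) j) by rewrite /pos cast_ordKV.
set j' := cast_ord _ _.
have /(congr1 (fun g => nat_of_ord (tnth (g i) j'))) :=
  congr1 (fun g : {dffun _} => fun i => g i) fE.
by rewrite !ffunE !tnth_mktuple !inordK // entry.
Qed.

Variable d : 'I_k -> nat.

Lemma card_block_deg_le B (c : pred nat) :
  (#|[set m : 'X_{1..N < B} |
        [forall i, block_deg m i <= d i] && c (mdeg m)]|
    <= \sum_(e : {dffun forall i : 'I_k, 'I_(d i).+1} | c (\sum_i e i))
         \prod_i 'C(n i - 1 + e i, e i))%N.
Proof.
pose deg (m : 'X_{1..N < B}) : {dffun forall i : 'I_k, 'I_(d i).+1} :=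
  [ffun i => inord (block_deg m i)].
have degE (m : 'X_{1..N < B}) i :
    [forall i, block_deg m i <= d i]%N -> deg m i = block_deg m i :> nat.
  by move=> /forallP md; rewrite ffunE inordK // ltnS.
rewrite -sum1_card (partition_big deg (fun e => c (\sum_i e i)%N)) /=; last first.
  move=> m; rewrite inE => /andP[md]; rewrite mdeg_block.
  by under eq_bigr => i _ do rewrite -degE //.
apply: leq_sum => e _; apply: leq_trans (card_block_deg_eq B (fun i => e i)).
rewrite sum1_card; apply/subset_leq_card/subsetP => m.
rewrite unfold_in !inE => /andP[/andP[md _] /eqP <-].
by apply/forallP => i; rewrite degE.
Qed.
End Counting.
End Blocks.

(** * The affine chart of the Segre-Veronese embedding *)

Section Dehomogenisation.
Variables (k : nat) (n d : 'I_k -> nat).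
Local Notation N := #|{: {i : 'I_k & 'I_(n i)}}|.
Local Notation idx := (tensor_idx n d).

(** The monomial that the coordinate t of the Segre-Veronese embedding becomes
    on the chart where the 0-th coordinate of every factor is 1: the exponent of
    the variable (i, j) counts the copies of factor i in which t selects the
    basis vector j + 1. *)
Definition index_mnm (t : idx) : 'X_{1..N} :=
  [multinom let u := enum_val l in
     \sum_(s < d (tag u)) (t (tag u) s == lift ord0 (tagged u) : nat)%N | l < N].

Lemma index_mnmE (t : idx) i (j : 'I_(n i)) :
  index_mnm t (block_var j) = (\sum_(s < d i) (t i s == lift ord0 j))%N.
Proof. by rewrite mnmE enum_rankK. Qed.

Lemma eq_index_mnm (t t' : idx) :
  (forall i (j : 'I_(n i)),
     index_mnm t (block_var j) = index_mnm t' (block_var j)) ->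
  index_mnm t = index_mnm t'.
Proof.
move=> E; apply/mnmP => l; rewrite -[l]enum_valK; case: (enum_val l) => i j.
exact: E.
Qed.

Lemma sum_lift_eq q (x : 'I_q.+1) :
  ((x == ord0) + \sum_(j < q) (x == lift ord0 j) = 1)%N.
Proof.
case: (unliftP ord0 x) => [j|] -> //.
  rewrite (bigD1 j) //= eqxx big1 => [|j' jj']; first by rewrite addn0.
  by rewrite (inj_eq (@lift_inj _ ord0)) eq_sym (negbTE jj').
by rewrite eqxx big1 // => j _; rewrite (negbTE (neq_lift ord0 j)).
Qed.

Lemma index_mnm_block_deg (t : idx) i :
  ((\sum_(s < d i) (t i s == ord0)) + block_deg (index_mnm t) i = d i)%N.
Proof.
rewrite -[RHS]card_ord -sum1_card /block_deg.
under [X in (_ + X)%N]eq_bigr => j _ do rewrite index_mnmE.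
rewrite exchange_big -big_split; apply: eq_bigr => s _ /=; exact: sum_lift_eq.
Qed.

Lemma index_mnm_permute sg (t : idx) : index_mnm (permute_idx sg t) = index_mnm t.
Proof.
apply: eq_index_mnm => i j; rewrite !index_mnmE.
rewrite [RHS](reindex_inj (@perm_inj _ (sg i))).
by apply: eq_bigr => s _; rewrite !ffunE.
Qed.

(** The monomial records how often each basis vector with nonzero label occurs
    in t i; the label 0 fills the remaining copies, so the multiset of labels is
    known in each block, and t i is known up to a permutation. *)
Lemma index_mnm_inj (t t' : idx) : index_mnm t = index_mnm t' ->
  exists sg, t' = permute_idx sg t.
Proof.
move=> tt'.
have countE (u : idx) i j : count_mem j (codom (u i)) = (\sum_s (u i s == j))%N.
  by rewrite -sum1_count big_map big_enum_cond big_mkcond.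
have count_eq i j : count_mem j (codom (t' i)) = count_mem j (codom (t i)).
  rewrite !countE; case: (unliftP ord0 j) => [j'|] ->.
    by rewrite -!index_mnmE tt'.
  apply/eqP; rewrite -(eqn_add2r (block_deg (index_mnm t) i)).
  by rewrite {1}tt' !index_mnm_block_deg.
have perm_i i : exists sg : 'S_(d i), forall s, t' i s = t i (sg s).
  have /tuple_permP[sg sgE] :
      perm_eq [tuple t' i s | s < d i] [tuple t i s | s < d i].
    by apply/allP => j _; apply/eqP; exact: count_eq.
  exists sg => s.
  have := congr1 (fun u : (d i).-tuple _ => tnth u s) (val_inj sgE).
  by rewrite !tnth_mktuple.
have [sg sgP] := fin_all_exists perm_i.
by exists sg; apply/ffunP => i; rewrite ffunE; apply/ffunP => s; rewrite ffunE.
Qed.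

Definition affine_point (R : nzRingType) (x : 'I_N -> R) i : 'rV[R]_(n i).+1 :=
  \row_j oapp (fun j' : 'I_(n i) => x (block_var j')) 1 (unlift ord0 j).

Lemma affine_point_neq0 (R : nzRingType) (x : 'I_N -> R) i :
  affine_point x i != 0.
Proof.
apply: contraNneq (oner_neq0 R) => /rowP/(_ ord0).
by rewrite !mxE unlift_none => /eqP.
Qed.

Lemma meval_index_mnm (K : fieldType) (x : 'I_N -> K) (t : idx) :
  'X_[index_mnm t].@[x] = segre_veronese d (affine_point x) t.
Proof.
rewrite mevalX big_block ffunE; apply: eq_bigr => i _.
under eq_bigr => j _ do rewrite index_mnmE expr_sum.
rewrite exchange_big; apply: eq_bigr => s _ /=; rewrite mxE.
case: (unliftP ord0 (t i s)) => [j|] -> /=.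
  rewrite (bigD1 j) //= eqxx expr1 big1 ?mulr1 // => j' jj'.
  by rewrite (inj_eq (@lift_inj _ ord0)) eq_sym (negbTE jj').
by rewrite big1 // => j _; rewrite (negbTE (neq_lift ord0 j)).
Qed.

Definition dehom (K : fieldType) (p : {mpoly K[#|{: idx}|]}) : {mpoly K[N]} :=
  mmap (@mpolyC N K) (fun j => 'X_[index_mnm (enum_val j : idx)]) p.

HB.instance Definition _ (K : fieldType) := GRing.RMorphism.copy (@dehom K)
  (mmap (@mpolyC N K) (fun j => 'X_[index_mnm (enum_val j : idx)])).

Lemma dehomX (K : fieldType) (t : idx) :
  dehom ('X_(enum_rank t) : {mpoly K[_]}) = 'X_[index_mnm t].
Proof. by rewrite /dehom mmapX mmap1U enum_rankK. Qed.

Lemma dehom_eval (K : fieldType) (x : 'I_N -> K) p :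
  (dehom p).@[x] = p.@[fun j => segre_veronese d (affine_point x) (enum_val j)].
Proof.
rewrite /dehom /mmap raddf_sum mevalE; apply: eq_bigr => m _ /=.
rewrite mevalM mevalC; congr (_ * _); rewrite /mmap1 rmorph_prod.
by apply: eq_bigr => j _; rewrite rmorphXn /= meval_index_mnm.
Qed.

Lemma pullback_dehom (K : fieldType) (A : falgType K)
    (pi : {lrmorphism {mpoly K[N]} -> A}) p :
  pullback (fun t : idx => pi 'X_[index_mnm t]) p = pi (dehom p).
Proof.
rewrite /pullback /dehom /mmap raddf_sum; apply: eq_bigr => m _ /=.
rewrite mul_mpolyC linearZ mulr_algl; congr (_ *: _); rewrite /mmap1 rmorph_prod.
by apply: eq_bigr => j _; rewrite rmorphXn.
Qed.

Definition base_idx : idx := [ffun i => [ffun s => ord0]].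

Hypothesis d_gt0 : forall i, (0 < d i)%N.

Lemma index_mnm_base : index_mnm base_idx = 0%MM.
Proof.
apply/mnmP => l; rewrite -[l]enum_valK; case: (enum_val l) => i j.
rewrite -[enum_rank _]/(block_var j) index_mnmE mnm0E big1 // => s _.
by rewrite !ffunE (negbTE (neq_lift ord0 j)).
Qed.

Lemma index_mnm_var l : exists t : idx, index_mnm t = U_(l)%MM.
Proof.
pose u := enum_val l; pose s0 i : 'I_(d i) := Ordinal (d_gt0 i).
exists [ffun i => [ffun s => if s == s0 i then insubd ord0
   (if tag u == i then (val (tagged u)).+1 else 0)%N else ord0]].
apply/mnmP => l'; rewrite -[l']enum_valK; case: (enum_val l') => i j.
rewrite -[enum_rank _]/(block_var j) index_mnmE (bigD1 (s0 i)) //=.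
rewrite big1 => [|s ss0]; last first.
  by rewrite !ffunE (negbTE ss0) (negbTE (neq_lift ord0 j)).
rewrite addn0 !ffunE eqxx mnm1E -[l]enum_valK /block_var (inj_eq enum_rank_inj) -/u.
case: u => i' j' /=; have [E|ii'] := eqVneq i' i; last first.
  by rewrite -val_eqE val_insubd /= -tag_eqE /tag_eq /= (negbTE ii').
subst i'; rewrite -val_eqE val_insubd /= ltnS ltn_ord /bump /= add1n eqSS.
by rewrite -tag_eqE /tag_eq /= eqxx tagged_asE val_eqE.
Qed.

(** The coordinate of base_idx becomes 1, so powers of it can raise the degree of
    a form without changing its image; this allows adding forms of different
    degrees. *)
Lemma dehom_onto (K : fieldType) (q : {mpoly K[N]}) :
  exists m (p : {mpoly K[#|{: idx}|]}), p \is m.-homog /\ dehom p = q.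
Proof.
pose P (q : {mpoly K[N]}) :=
  exists m (p : {mpoly K[#|{: idx}|]}), p \is m.-homog /\ dehom p = q.
pose z0 : {mpoly K[#|{: idx}|]} := 'X_(enum_rank base_idx).
have z0_homog m : z0 ^+ m \is m.-homog.
  by rewrite -[X in X.-homog]mul1n; apply: dhomogMn; rewrite dhomogX /= mdeg1.
have z0_dehom m : dehom (z0 ^+ m) = 1.
  by rewrite rmorphXn /= dehomX index_mnm_base mpolyX0 expr1n.
have PM q1 q2 : P q1 -> P q2 -> P (q1 * q2).
  move=> [m1 [p1 [h1 <-]]] [m2 [p2 [h2 <-]]]; exists (m1 + m2)%N, (p1 * p2).
  by rewrite rmorphM dhomogM.
have PD q1 q2 : P q1 -> P q2 -> P (q1 + q2).
  move=> [m1 [p1 [h1 <-]]] [m2 [p2 [h2 <-]]].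
  exists (m1 + m2)%N, (p1 * z0 ^+ m2 + z0 ^+ m1 * p2).
  by rewrite rmorphD !rmorphM /= !z0_dehom mulr1 mul1r dhomogD ?dhomogM.
have PC c : P c%:MP.
  exists 0%N, c%:MP; split; last exact: mmapC.
  by rewrite -[c%:MP]mulr1 mul_mpolyC dhomogZ ?dhomog1.
have PX l : P 'X_l.
  have [t tl] := index_mnm_var l; exists 1%N, 'X_(enum_rank t).
  by rewrite dehomX tl dhomogX /= mdeg1.
rewrite -/(P q) [q]mpolyE; apply: (big_ind P _ PD) => [|m _]; first by rewrite -mpolyC0.
rewrite -mul_mpolyC; apply: (PM) => //; rewrite mpolyXE_id.
apply: (big_ind P _ PM) => [|l _]; first by rewrite -mpolyC1.
by elim: (m l) => [|e IH]; rewrite ?expr0 -?mpolyC1 // exprS; apply: PM.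
Qed.

(** * The apolar scheme of a tensor *)

Section ApolarTensor.
Variables (K : numClosedFieldType) (F : {ffun idx -> K^o}).
Hypotheses (F_sym : block_symmetric F) (F_neq0 : F != 0).
Let D := (\sum_i d i)%N.

(** Contraction against the dehomogenisation of F, written in divided powers:
    its coefficient at a monomial m is the entry of F at any t giving m, and 0
    when m lies outside the box of multidegrees bounded by d. *)
Let dual_coef (m : 'X_{1..N}) : K^o :=
  if [pick t : idx | index_mnm t == m] is Some t then F t else 0.

Let phi (p : {mpoly K[N]}) : K^o := \sum_(m : 'X_{1..N < D.+1}) p@_m * dual_coef m.

Lemma phi_linear : linear phi.
Proof.
move=> a p q; rewrite /phi scaler_sumr -big_split; apply: eq_bigr => m _ /=.
by rewrite mcoeffD mcoeffZ mulrDl -mulrA.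
Qed.

HB.instance Definition _ := GRing.isLinear.Build _ _ _ _ phi phi_linear.

Lemma dual_coef_index t : dual_coef (index_mnm t) = F t.
Proof.
rewrite /dual_coef; case: pickP => [t' /eqP tt'|/(_ t)]; last by rewrite eqxx.
by have [sg ->] := index_mnm_inj tt'; rewrite F_sym.
Qed.

Lemma dual_coef_supp m : dual_coef m != 0 -> forall i, (block_deg m i <= d i)%N.
Proof.
rewrite /dual_coef; case: pickP => [t /eqP <- _ i|_]; last by rewrite eqxx.
by rewrite -[leqRHS](index_mnm_block_deg t i) leq_addl.
Qed.

Lemma phi_mnm m : phi 'X_[m] = dual_coef m.
Proof.
rewrite /phi; under eq_bigr => m' _ do rewrite mcoeffX.
have [c0|cN0] := eqVneq (dual_coef m) 0.
  by rewrite c0 big1 // => m' _; case: eqP => [<-|_]; rewrite ?c0 ?mulr0 ?mul0r.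
have mD : (mdeg m < D.+1)%N.
  by rewrite ltnS mdeg_block leq_sum // => i _; apply: dual_coef_supp.
rewrite (bigD1 (BMultinom mD)) //= eqxx mul1r big1 ?addr0 // => m'.
by rewrite -val_eqE /= eq_sym => /negbTE ->; rewrite mul0r.
Qed.

(** The scheme is Spec of the apolar algebra, placed in the standard affine chart
    of the product by sending the coordinate t to the class of index_mnm t.  Its
    linear span contains F since psi maps that class to F t: any linear
    equations satisfied by the classes are satisfied by F.  For the length, two
    monomials whose product does not vanish under phi have multidegrees adding
    up to at most d, so if the first has total degree above D / 2 then the
    second has total degree below D / 2. *)
Lemma apolar_scheme :
  exists2 r, in_span_of_length F r &
  (r <= #|[set m : 'X_{1..N < D.+1} |
             [forall i, block_deg m i <= d i] && (2 * mdeg m <= D)]|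
      + #|[set m : 'X_{1..N < D.+1} |
             [forall i, block_deg m i <= d i] && (2 * mdeg m < D)]|)%N.
Proof.
have supp m : phi 'X_[m] != 0 -> forall i, (block_deg m i <= d i)%N.
  by rewrite phi_mnm; apply: dual_coef_supp.
have phi_high m : (D < mdeg m)%N -> phi 'X_[m] = 0.
  move=> Dm; apply: contraTeq Dm => /supp mb.
  by rewrite -leqNgt mdeg_block leq_sum.
have phi_neq0 : exists p, phi p != 0.
  have [t Ft] : exists t, F t != 0.
    apply/existsP; apply: contraNT F_neq0; rewrite negb_exists => /forallP F0.
    by apply/eqP/ffunP => t; rewrite ffunE; apply/eqP; rewrite -[_ == _]negbK.
  by exists 'X_[index_mnm t]; rewrite phi_mnm dual_coef_index.
have [A [pi [psi [onto psi_pi nondeg]]]] := @apolar_algebra _ _ _ phi phi_high phi_neq0.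
have pi_high m : (D < mdeg m)%N -> pi 'X_[m] = 0.
  move=> Dm; apply: nondeg => b; have [p ->] := onto b.
  by rewrite -rmorphM psi_pi mulrC (apolar_mul_high phi_high).
pose a (t : idx) : A := pi 'X_[index_mnm t].
have a_base : a base_idx = 1 by rewrite /a index_mnm_base mpolyX0 rmorph1.
exists (\dim {:A}).
  exists A, a; split.
  - move=> b c; have [p ->] := onto b; have [q ->] := onto c.
    by rewrite -!rmorphM mulrC.
  - split; [|split].
    + by move=> sg t; rewrite /a index_mnm_permute.
    + exists (fun t => (t == base_idx)%:R).
      rewrite (bigD1 base_idx) //= eqxx a_base mulr1 big1 ?addr0 // => t /negbTE ->.
      by rewrite mul0r.
    (* The scheme is supported at the origin of the chart, so a coordinate is
       either the constant 1 or nilpotent; in the second case the open set where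
       it is invertible is empty, and any equation holds there. *)
    + move=> t b s; have [t0|tN0] := eqVneq (index_mnm t) 0%MM.
        have at1 : a t = 1 by rewrite -a_base /a t0 index_mnm_base.
        have [q ->] := onto b; have [m [p [p_homog <-]]] := dehom_onto q.
        exists m, 0%N, p; split=> //.
        by rewrite pullback_dehom at1 !expr1n !mul1r subrr.
      have at0 : a t ^+ D.+1 = 0.
        rewrite /a -rmorphXn mpolyXn; apply: pi_high.
        by rewrite mdegMn leq_pmull // lt0n mdeg_eq0.
      by exists 0%N, D.+1, 1; rewrite at0 mul0r; split; first exact: dhomog1.
  - move=> m p _ p0; rewrite pullback_dehom.
    have -> : dehom p = 0; last by rewrite rmorph0.
    apply: mpoly_eq0_eval => x; rewrite dehom_eval p0 // => i.
    exact: affine_point_neq0.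
  - by [].
  - move=> W _ [c cE].
    have -> : F = \sum_j (psi (c j) : K) *: tnth (vbasis W) j.
      apply/ffunP => t; rewrite -dual_coef_index -phi_mnm -psi_pi -/(a t) cE linear_sum.
      rewrite sum_ffunE; apply: eq_bigr => j _.
      by rewrite linearZ_LR ffunE; apply: mulrC.
    by apply: rpred_sum => j _; apply/rpredZ/vbasis_mem/mem_tnth.
pose box (c : pred nat) := [set m : 'X_{1..N < D.+1} |
  [forall i, block_deg m i <= d i]%N && c (mdeg m)].
pose L c := [seq bmnm m | m in box c].
have L_size c : size (L c) = #|box c| by exact: size_image.
have L_mem (c : pred nat) m :
    (forall i, block_deg m i <= d i)%N -> c (mdeg m) -> m \in L c.
  move=> mb cm; have mD : (mdeg m < D.+1)%N by rewrite ltnS mdeg_block leq_sum.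
  by apply/imageP; exists (BMultinom mD) => //; rewrite inE cm andbT; apply/forallP.
rewrite -(L_size (fun s => 2 * s <= D)%N) -(L_size (fun s => 2 * s < D)%N).
apply: (apolar_dim_le onto nondeg pi_high) => m m' mL m'L.
rewrite psi_pi; apply: contraNeq mL => /supp mb.
have mb1 i : (block_deg m i <= d i)%N.
  by apply: leq_trans (mb i); rewrite block_degD leq_addr.
have mb2 i : (block_deg m' i <= d i)%N.
  by apply: leq_trans (mb i); rewrite block_degD leq_addl.
apply: (L_mem) => //; have : (D <= 2 * mdeg m')%N.
  by rewrite leqNgt; apply: contraNN m'L => m'D; apply: L_mem.
have : (mdeg m + mdeg m' <= D)%N by rewrite -mdegD mdeg_block leq_sum.
by rewrite !mul2n -!addnn => *; lia.
Qed.
End ApolarTensor.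
End Dehomogenisation.

(** * The bound *)

Theorem corollary1p4 (R : realType) (k : nat) (n d : 'I_k -> nat)
    (k_gt0 : (0 < k)%N)
    (n_gt0 : forall i, (0 < n i)%N) (d_gt0 : forall i, (0 < d i)%N)
    (F : {ffun tensor_idx n d -> (complex R)^o})
    (F_sym : block_symmetric F) (F_neq0 : F != 0%R) :
  exists2 r : nat, is_cactus_rank F r &
    (r <= \sum_(e : {dffun forall i : 'I_k, 'I_(d i).+1}
                 | 2 * (\sum_(i < k) e i) <= \sum_(i < k) d i)
             \prod_(i < k) 'C(n i - 1 + e i, e i)
          + \sum_(e : {dffun forall i : 'I_k, 'I_(d i).+1}
                 | 2 * (\sum_(i < k) e i) > \sum_(i < k) d i)
             \prod_(i < k) 'C(n i - 1 + (d i - e i), d i - e i))%N.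
Proof.
have [r0 r0P r0_le] := apolar_scheme d_gt0 F_sym F_neq0.
have exP : exists r, `[< in_span_of_length F r >] by exists r0; apply/asboolP.
case: (ex_minnP exP) => r /asboolP rP r_min.
exists r; first by split=> // r' /asboolP; apply: r_min.
apply: leq_trans (r_min _ (asboolT r0P)) _; apply: leq_trans r0_le _.
set D := (\sum_i d i)%N; apply: leq_add.
  exact: (card_block_deg_le n_gt0 d D.+1 (fun s => 2 * s <= D)%N).
apply: leq_trans (card_block_deg_le n_gt0 d D.+1 (fun s => 2 * s < D)%N) _.
(* Reindexing by e |-> d - e exchanges total degrees below and above D / 2. *)
pose opp (e : {dffun forall i : 'I_k, 'I_(d i).+1}) :
  {dffun forall i : 'I_k, 'I_(d i).+1} := [ffun i => rev_ord (e i)].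
have oppK : involutive opp.
  by move=> e; apply/ffunP => i; rewrite !ffunE rev_ordK.
have oppE e i : opp e i = (d i - e i)%N :> nat by rewrite ffunE /= subSS.
have opp_sum e : (\sum_i opp e i + \sum_i e i = D)%N.
  rewrite -big_split; apply: eq_bigr => i _ /=.
  by rewrite oppE subnK // -ltnS.
rewrite (reindex_inj (inv_inj oppK)) leq_eqVlt; apply/orP; left; apply/eqP.
apply: eq_big => [e|e _] /=.
  by move: (opp_sum e); move: (\sum_i _)%N (\sum_i e i)%N => x y; lia.
by apply: eq_bigr => i _; rewrite oppE.
Qed.
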